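(* Any inference task $(g_0,g_1)$ with information parameters $\bar\beta=(\beta_1,\beta_2,\beta_3,\beta_4)$, $\beta_1>0$, is strongly equivalent to the inference task $(g^{\bar\beta}_{U,0},g^{\bar\beta}_{U,1})$ given by $$g^{\bar\beta}_{U,0}(y,w)=-\frac1{2\beta_1}(y-\beta_2w-\beta_4)^2-\frac12\log(2\pi\beta_1),\qquad g^{\bar\beta}_{U,1}(y,w)=-\frac12(y-w)^2-\frac{\beta_3-1}{2}w^2 .$$
   Context: An inference task $(g_0,g)$ is a pair consisting of a log-likelihood $g_0(y,w)$ (for each $w$ near $0$, $e^{g_0(\cdot,w)}$ is a probability density with respect to a reference measure $dy$ which is Lebesgue measure on $\mathbb{R}$ or counting measure on a countable subset of $\mathbb{R}$) and a pseudo-likelihood $g(y,w)$, lying in $\mathcal{F}_0$: both functions are measurable on $\mathbb{R}\times U$ ($U$ an open neighbourhood of $0$), three times continuously differentiable in $w$, and, with $(f_1,f_2)=(g_0,g)$, for $i=1,2$ the quantities $\int e^{f_i(y,0)}dy$, $\int|\partial_wf_i(y,0)|^4e^{f_1(y,0)}dy$, $\|\partial_w^2f_i(\cdot,0)\|_\infty$, $\|\partial_w^3f_i(\cdot,\cdot)\|_\infty$ are finite. Let $\mathbb{P}_0$ be the law with density $e^{g_0(y,0)}$. The information parameters of $(g_0,g)$ are $\beta_1=\mathbb{E}_{\mathbb{P}_0}[(\partial_wg(Y,0)-\mathbb{E}_{\mathbb{P}_0}\partial_wg(Y,0))^2]$, $\beta_2=\mathbb{E}_{\mathbb{P}_0}[\partial_wg(Y,0)\,\partial_wg_0(Y,0)]$,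 $\beta_3=-\mathbb{E}_{\mathbb{P}_0}[\partial_w^2g(Y,0)]$, $\beta_4=\mathbb{E}_{\mathbb{P}_0}[\partial_wg(Y,0)]$. Two inference tasks are strongly equivalent if they have the same information parameters. *)

(* Defs.v *)
From HB Require Import structures.
From mathcomp Require Import all_boot all_order all_algebra.
From mathcomp Require Import all_classical all_reals all_analysis.
From mathcomp Require Import measurable_realfun.

Set Implicit Arguments.
Unset Strict Implicit.
Unset Printing Implicit Defensive.

Import Order.TTheory GRing.Theory Num.Theory.
Import numFieldNormedType.Exports.

Local Open Scope classical_set_scope.
Local Open Scope ring_scope.

(* Likelihoods are total functions f y w on R * R, with y the observation and
   w the parameter; only their values for w in a neighbourhood U of 0 matter. *)

Section InferenceTasks.
Context {R : realType}.
Local Notation RB := (measurableTypeR R).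
Implicit Types (mu : {measure set RB -> \bar R}) (f g : R -> R -> R).

Definition is_reference_measure mu : Prop :=
  (forall A : set RB, measurable A -> mu A = lebesgue_measure A) \/
  (exists2 S : set RB, countable S &
    forall A : set RB, measurable A -> mu A = counting (A `&` S)).

Definition dw (k : nat) f (y w : R) : R := derive1n k (f y) w.

(* f y is C^3 on U. U being open, the iterated derivatives at the points of U
   do not depend on the values of f y outside U. *)
Definition C3_on (U : set R) f : Prop :=
  forall y w, U w ->
    (forall k, (k < 3)%N -> derivable (dw k f y) w 1) /\
    {for w, continuous (dw 3 f y)}.

(* ||.||_oo is the supremum over all points, not an essential supremum. *)
Definition sup_norm (I : Type) (D : set I) (h : I -> R) : \bar R :=
  ereal_sup [set (`|h i|)%:E | i in D].

Definition F0_cond mu (U : set R) (g0 f : R -> R -> R) : Prop :=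
  [/\ measurable_fun ([set: RB] `*` (U : set RB))
        (fun p : RB * RB => f p.1 p.2),
      C3_on U f,
      (\int[mu]_y (expR (f y 0))%:E < +oo)%E,
      (\int[mu]_y (`|dw 1 f y 0| ^+ 4 * expR (g0 y 0))%:E < +oo)%E &
      (sup_norm [set: R] (fun y => dw 2 f y 0) < +oo)%E /\
      (sup_norm ([set: R] `*` U) (fun p => dw 3 f p.1 p.2) < +oo)%E].

Record is_inference_task mu (g0 g : R -> R -> R) : Prop := IsInferenceTask {
  task_reference : is_reference_measure mu ;
  task_density :
    \forall w \near (0 : R), (\int[mu]_y (expR (g0 y w))%:E = 1)%E ;
  task_F0 : exists U : set R,
    [/\ open U, U 0, F0_cond mu U g0 g0 & F0_cond mu U g0 g] }.

End InferenceTasks.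

Record inference_task (R : realType) := InferenceTask {
  ref_measure : {measure set (measurableTypeR R) -> \bar R} ;
  log_lik : R -> R -> R ;
  pseudo_lik : R -> R -> R ;
  task_axioms : is_inference_task ref_measure log_lik pseudo_lik }.

Definition law0 (R : realType) (T : inference_task R)
    (A : set (measurableTypeR R)) : \bar R :=
  (\int[ref_measure T]_(y in A) (expR (log_lik T y 0))%:E)%E.

Section Law0.
Context (R : realType) (T : inference_task R).

Let measurable_density :
  measurable_fun [set: measurableTypeR R]
    (fun y : measurableTypeR R => (expR (log_lik T y 0))%:E).
Proof.
have [_ _ [U [oU U0 [mg0 _ _ _ _] _]]] := task_axioms T.
apply/measurable_EFinP; apply: measurableT_comp => //.
apply: (measurable_comp _ _ mg0) (pair2_measurable (0 : measurableTypeR R)).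
- by apply: measurableX => //; exact: open_measurable.
- by move=> _ [y _ <-].
Qed.

Let law00 : law0 T set0 = 0%E.
Proof. by rewrite /law0 integral_set0. Qed.

Let law0_ge0 A : (0 <= law0 T A)%E.
Proof. by apply: integral_ge0 => y _; rewrite lee_fin expR_ge0. Qed.

Let law0_sigma_additive : semi_sigma_additive (law0 T).
Proof.
move=> /= A mA tA mUA.
rewrite /law0 ge0_integral_bigcup//=.
- apply: is_cvg_ereal_nneg_natsum_cond => n _ _.
  exact: law0_ge0.
- exact: measurable_funS measurable_density.
Qed.

HB.instance Definition _ := isMeasure.Build _ _ _
  (law0 T) law00 law0_ge0 law0_sigma_additive.

Let law0_setT : law0 T setT = 1%E.
Proof. exact: nbhs_singleton (task_density (task_axioms T)). Qed.

HB.instance Definition _ :=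
  @Measure_isProbability.Build _ _ R (law0 T) law0_setT.

End Law0.

Section InformationParameters.
Context {R : realType}.
Implicit Type T : inference_task R.

(* fine loses nothing here: under the integrability conditions of an inference
   task all four expectations are finite. *)
Definition info4 T : R := fine 'E_(law0 T)[fun y => dw 1 (pseudo_lik T) y 0].

Definition info1 T : R :=
  fine 'E_(law0 T)[fun y => (dw 1 (pseudo_lik T) y 0 - info4 T) ^+ 2].

Definition info2 T : R :=
  fine 'E_(law0 T)[fun y => dw 1 (pseudo_lik T) y 0 * dw 1 (log_lik T) y 0].

Definition info3 T : R := - fine 'E_(law0 T)[fun y => dw 2 (pseudo_lik T) y 0].

Definition info_params T : R * R * R * R :=
  (info1 T, info2 T, info3 T, info4 T).

Definition strongly_equivalent T1 T2 : Prop :=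
  info_params T1 = info_params T2.

Definition gU0 (b : R * R * R * R) (y w : R) : R :=
  let: (b1, b2, b3, b4) := b in
  - (2 * b1)^-1 * (y - b2 * w - b4) ^+ 2 - 2^-1 * ln (2 * pi * b1).

Definition gU1 (b : R * R * R * R) (y w : R) : R :=
  let: (b1, b2, b3, b4) := b in
  - 2^-1 * (y - w) ^+ 2 - (b3 - 1) / 2 * w ^+ 2.

End InformationParameters.

(* Main.v *)
Require Import Defs.
From HB Require Import structures.
From mathcomp Require Import all_boot all_order all_algebra.
From mathcomp Require Import all_classical all_reals all_analysis.
From mathcomp Require Import measurable_realfun ring.
Import Order.TTheory GRing.Theory Num.Theory.
Import numFieldNormedType.Exports.
Local Open Scope classical_set_scope.
Local Open Scope ring_scope.

(** Under the Gaussian task with parameters [(b1, b2, b3, b4)] the law of the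
    observation is the normal law of mean [b4] and variance [b1], because
    [expR (gU0 b y w)] is the normal density of mean [b2 * w + b4] and standard
    deviation [Num.sqrt b1] ([expR_gU0]).  Both log-likelihoods are polynomials of
    degree 2 in [w] whose leading coefficient does not depend on [y]
    ([gU0_quad], [gU1_quad]): their second derivative is constant and their
    third one vanishes, so the regularity conditions reduce to the finiteness
    of fourth moments of affine functions of a normal variable
    ([F0_cond_quad], [normal_affine_moment4_lty]).

    The scores at [w = 0] are [y] for the pseudo-likelihood and
    [(b2 / b1) * (y - b4)] for the likelihood, and the second derivative of the
    pseudo-likelihood is [- b3].  The information parameters are thus the
    variance [b1], the covariance [(b2 / b1) * b1 = b2], [b3] and the mean [b4]
    ([info_params_gU]), which are the prescribed numbers.

    The analytic content is the mean and the variance of the normal law.  With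
    [p] the density of mean [m] and standard deviation [s], the identity
    [p' = - (x - m) / s ^+ 2 * p] makes [(x - m) * p] and
    [(x - m) ^+ 2 * p - s ^+ 2 * p] the derivatives of [- s ^+ 2 * p] and
    [- s ^+ 2 * (x - m) * p], which vanish at both infinities; the fundamental
    theorem of calculus on the whole line ([integrable_FTC2_setT]) then says
    that their integrals are 0.  Integrability and decay at infinity both come
    from one estimate, [normal_pdf_moment4_le]. *)

(** * Derivative and decay of the normal density *)

Section NormalDensity.
Context {R : realType}.
Implicit Types m s x : R.
Local Notation mu := (@lebesgue_measure R).

Lemma is_derive_normal_pdf m s x : s != 0 ->
  is_derive x 1 (normal_pdf m s) (- (x - m) / s ^+ 2 * normal_pdf m s x).
Proof.
move=> s0.
have sq : is_derive x 1 (fun z => - (z - m) ^+ 2 / (s ^+ 2 *+ 2))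
    (- (x - m) / s ^+ 2).
  have -> : (fun z => - (z - m) ^+ 2 / (s ^+ 2 *+ 2)) =
      (- (s ^+ 2 *+ 2)^-1) \*: (id - cst m) ^+ 2.
    by apply/funext => z; rewrite /= !fctE /GRing.scale/=; ring.
  apply: is_derive_eq.
  by rewrite /GRing.scale/= !fctE/= subr0 expr1; field.
have -> : normal_pdf m s =
    normal_peak s \*: (expR \o (fun z => - (z - m) ^+ 2 / (s ^+ 2 *+ 2))).
  by apply/funext => z; rewrite (normal_pdfE m s0).
apply: is_derive_eq.
by rewrite [LHS]mulrA mulrC.
Qed.

(** Doubling the standard deviation absorbs the polynomial factor: with
    [z = (x - m) ^+ 2 / (8 * s ^+ 2)] the two densities are multiples of
    [expR (- z) ^+ 4] and [expR (- z)], the factor is a multiple of [z ^+ 2],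
    and [z * expR (- z) <= 1].  The bound is again a normal density, hence
    integrable. *)
Lemma normal_pdf_moment4_le m s x : 0 < s ->
  (x - m) ^+ 4 * normal_pdf m s x <= 128 * s ^+ 4 * normal_pdf m (2 * s) x.
Proof.
move=> s0.
have s2 : 0 < 2 * s by rewrite mulr_gt0.
have peak2 : normal_peak (2 * s) = normal_peak s / 2.
  rewrite /normal_peak -invfM.
  have -> : (2 * s) ^+ 2 * pi *+ 2 = 2 ^+ 2 * (s ^+ 2 * pi *+ 2) by ring.
  by rewrite sqrtrM ?sqr_ge0// sqrtr_sqr ger0_norm// mulrC.
rewrite !normal_pdfE ?gt_eqF// peak2 /normal_fun.
set t := x - m.
pose z := t ^+ 2 / (8 * s ^+ 2).
have z0 : 0 <= z by rewrite divr_ge0 ?sqr_ge0// mulr_ge0 ?sqr_ge0.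
have -> : - t ^+ 2 / (s ^+ 2 *+ 2) = - z + - z + - z + - z.
  by rewrite /z; field; rewrite gt_eqF.
have -> : - t ^+ 2 / ((2 * s) ^+ 2 *+ 2) = - z.
  by rewrite /z; field; rewrite gt_eqF.
have -> : t ^+ 4 = 64 * s ^+ 4 * z ^+ 2.
  by rewrite /z; field; rewrite gt_eqF.
have ze : z * expR (- z) <= 1.
  rewrite expRN ler_pdivrMr ?expR_gt0// mul1r.
  by rewrite (le_trans _ (expR_ge1Dx z))// lerDr.
have ze0 : 0 <= z * expR (- z) by rewrite mulr_ge0 ?expR_ge0.
have e1 : expR (- z) <= 1 by rewrite -expR0 ler_expR oppr_le0.
rewrite !expRD.
set e := expR (- z) in ze ze0 e1 *.
have e0 : 0 <= e by exact: expR_ge0.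
have p0 := normal_peak_ge0 s.
have -> : 64 * s ^+ 4 * z ^+ 2 * (normal_peak s * (e * e * e * e)) =
  64 * s ^+ 4 * normal_peak s * e * ((z * e) ^+ 2 * e) by ring.
have -> : 128 * s ^+ 4 * (normal_peak s / 2 * e) =
  64 * s ^+ 4 * normal_peak s * e by field.
apply: ler_piMr.
  by rewrite mulr_ge0// mulr_ge0// mulr_ge0// exprn_ge0// ltW.
by rewrite mulr_ile1 ?exprn_ge0// exprn_ile1.
Qed.

Lemma continuous_normal_moment m s k : s != 0 ->
  continuous (fun x => (x - m) ^+ k * normal_pdf m s x).
Proof.
move=> s0 x; apply: cvgM; last exact: continuous_normal_pdf.
apply: (cvg_comp (fun x => x - m) (fun x => x ^+ k)).
  by apply: (@cvgB _ R^o); [exact: cvg_id|exact: cvg_cst].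
exact: exprn_continuous.
Qed.

Lemma normr_exp_le_add1_exp4 (t : R) k : (k <= 4)%N -> `|t| ^+ k <= 1 + t ^+ 4.
Proof.
move=> k4.
have -> : t ^+ 4 = `|t| ^+ 4 by rewrite -normrX ger0_norm// exprn_even_ge0.
have [t1|t1] := leP `|t| 1.
  by rewrite (@le_trans _ _ 1) ?exprn_ile1// lerDl exprn_ge0.
by rewrite (@le_trans _ _ (`|t| ^+ 4)) ?lerDr// ler_weXn2l// ltW.
Qed.

Lemma integrable_normal_moment m s k : 0 < s -> (k <= 4)%N ->
  mu.-integrable setT (fun x => ((x - m) ^+ k * normal_pdf m s x)%:E).
Proof.
move=> s0 k4.
pose g x := normal_pdf m s x + 128 * s ^+ 4 * normal_pdf m (2 * s) x.
have ig : mu.-integrable setT (EFin \o g).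
  rewrite (_ : _ \o _ = (fun x => (normal_pdf m s x)%:E) \+
      (fun x => ((128 * s ^+ 4)%:E * (normal_pdf m (2 * s) x)%:E)))%E//.
  apply: integrableD => //; first exact: integrable_normal_pdf.
  by apply: integrableZl => //; exact: integrable_normal_pdf.
apply: le_integrable ig => //.
  apply/measurable_EFinP/measurable_funM; last exact: measurable_normal_pdf.
  by apply: measurable_funX; exact: measurable_funB.
move=> x _; rewrite /= lee_fin.
have p0 := normal_pdf_ge0 m s x.
rewrite [leRHS]ger0_norm; last first.
  rewrite /g addr_ge0 ?normal_pdf_ge0// mulr_ge0 ?normal_pdf_ge0//.
  by rewrite mulr_ge0// exprn_ge0// ltW.
rewrite normrM normrX [X in _ * X]ger0_norm//.
rewrite (le_trans (ler_wpM2r p0 (normr_exp_le_add1_exp4 _ _ k4)))//.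
by rewrite mulrDl mul1r /g lerD2l normal_pdf_moment4_le.
Qed.

(** Away from [m] the bound on the fourth moment density leaves a factor
    [1 / `|x - m|] as soon as [k <= 3].  The filter is arbitrary so that both
    infinities are covered at once. *)
Lemma cvg_normal_moment0 m s k (F : set_system R) (FF : Filter F) :
  0 < s -> (k <= 3)%N -> `|x - m| @[x --> F] --> +oo ->
  ((x - m) ^+ k * normal_pdf m s x) @[x --> F] --> (0 : R).
Proof.
move=> s0 k3 xoo.
pose C := 128 * s ^+ 4 * normal_peak (2 * s).
have C0 : 0 <= C by rewrite mulr_ge0 ?normal_peak_ge0// mulr_ge0// exprn_ge0// ltW.
have Voo : (fun x => `|x - m|^-1) @ F --> (0 : R).
  apply/gtr0_cvgV0 => //.
  by move/cvgryPgt : xoo => /(_ 0).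
apply: norm_cvg0.
apply: (@squeeze_cvgr _ _ _ _ (cst 0) (fun x => C * `|x - m|^-1)); last 2 first.
- exact: cvg_cst.
- by rewrite -[X in _ --> X](mulr0 C); apply: cvgM => //; exact: cvg_cst.
move/cvgryPge : xoo => /(_ 1); apply: filterS => x x1.
rewrite normr_ge0/=.
have t0 : 0 < `|x - m| by rewrite (lt_le_trans _ x1).
rewrite ler_pdivlMr// normrM normrX [X in _ * X * _]ger0_norm ?normal_pdf_ge0//.
rewrite mulrAC -exprSr (@le_trans _ _ ((x - m) ^+ 4 * normal_pdf m s x))//.
  rewrite ler_wpM2r ?normal_pdf_ge0//.
  rewrite -[leRHS]ger0_norm ?exprn_even_ge0// normrX.
  exact: ler_weXn2l.
rewrite (le_trans (normal_pdf_moment4_le m s x s0))//.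
rewrite ler_wpM2l// ?normal_pdf_ub ?gt_eqF ?mulr_gt0//.
by rewrite mulr_ge0// exprn_ge0// ltW.
Qed.

End NormalDensity.

(** * Moments of the normal law *)

Section WholeLine.
Context {R : realType}.
Local Notation mu := (@lebesgue_measure R).

(** The integrals of [f] over the segments from [- n] to [n] are the differences
    [F n - F (- n)], and they converge to the integral over the line because
    [`|f|] dominates the truncations. *)
Lemma integrable_FTC2_setT (f F : R -> R) (l l' : R) :
  continuous f -> mu.-integrable setT (EFin \o f) ->
  (forall x : R, is_derive x 1 F (f x)) ->
  F x @[x --> +oo] --> l -> F x @[x --> -oo] --> l' ->
  (\int[mu]_x (f x)%:E = (l - l')%:E)%E.
Proof.
move=> cf intf dF Fl Fl'.
have cF : continuous F.
  move=> x; apply: differentiable_continuous; apply/derivable1_diffP.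
  exact: (@ex_derive _ _ _ _ _ _ _ (dF x)).
pose I n := [set` `[- n%:R : R, n%:R]].
pose f_ n := (EFin \o f) \_ (I n).
have mI n : measurable (I n) by exact: measurable_itv.
have mf : measurable_fun setT (EFin \o f) by exact: measurable_int intf.
have [_ _ /=] : [/\ mu.-integrable setT (EFin \o f),
    [sequence \int[mu]_x `|f_ n x - (EFin \o f) x|]_n @ \oo --> 0 &
    [sequence \int[mu]_x f_ n x]_n @ \oo --> \int[mu]_x (EFin \o f) x]%E.
  apply: (@dominated_convergence _ _ _ mu setT measurableT f_ _
    (fun x => `|(f x)%:E|)%E) => //.
  - move=> n; apply/(measurable_restrictT _ (mI n)).
    exact: measurable_funS mf.
  - apply: aeW => x _; apply: cvg_near_cst.
    near=> n; apply/eqP; rewrite /f_ patchE mem_set// /I/= in_itv/= -ler_norml.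
    by near: n; exact: nbhs_infty_ger.
  - exact: integrable_abse.
  - apply: aeW => x n _; rewrite /f_ patchE; case: ifPn => // _.
    by rewrite abse0.
(* both sides are limits of the integrals over [I n] *)
move=> cvg1; apply: (cvg_unique _ cvg1) => //.
apply: (@cvg_trans _ ((F n%:R - F (- n%:R))%:E @[n --> \oo])).
  apply: near_eq_cvg; near=> n.
  have n0 : (0 < n)%N by near: n; exact: nbhs_infty_gt.
  rewrite /f_ -integral_mkcond (@continuous_FTC2 _ _ F)//.
  - by rewrite (@lt_trans _ _ 0) ?oppr_lt0 ?ltr0n.
  - exact: continuous_subspaceT.
  - split.
    + by move=> x _; exact: (@ex_derive _ _ _ _ _ _ _ (dF x)).
    + by apply: cvg_at_right_filter; exact: cF.
    + by apply: cvg_at_left_filter; exact: cF.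
  - by move=> x _; rewrite derive1E; exact: (@derive_val _ _ _ _ _ _ _ (dF x)).
apply: cvg_EFin; first exact: nearW.
apply: cvgB.
  exact: (cvg_comp _ _ (@cvgr_idn R) Fl).
apply: (cvg_comp _ _ _ Fl').
apply/cvgNry; rewrite (_ : - _ = (fun n => n%:R)); first exact: cvgr_idn.
by apply/funext => n; rewrite fctE opprK.
Unshelve. all: by end_near. Qed.

Lemma cvg_normal_moment0y (m s : R) k : 0 < s -> (k <= 3)%N ->
  ((x - m) ^+ k * normal_pdf m s x) @[x --> +oo] --> (0 : R).
Proof.
move=> s0 k3; apply: cvg_normal_moment0 => //.
apply/cvgryPge => A; near=> x; rewrite (le_trans _ (ler_norm _))// lerBrDr.
by near: x; apply: nbhs_pinfty_ge; exact: num_real.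
Unshelve. all: by end_near. Qed.

Lemma cvg_normal_moment0Ny (m s : R) k : 0 < s -> (k <= 3)%N ->
  ((x - m) ^+ k * normal_pdf m s x) @[x --> -oo] --> (0 : R).
Proof.
move=> s0 k3; apply: cvg_normal_moment0 => //.
apply/cvgryPge => A; near=> x; rewrite distrC (le_trans _ (ler_norm _))//.
rewrite lerBrDr -lerBrDl.
by near: x; apply: nbhs_ninfty_le; exact: num_real.
Unshelve. all: by end_near. Qed.

Lemma integral_normal_moment1 (m s : R) : 0 < s ->
  (\int[mu]_x ((x - m) * normal_pdf m s x)%:E = 0)%E.
Proof.
move=> s0; have s1 := lt0r_neq0 s0.
pose F x := - s ^+ 2 * normal_pdf m s x.
have dF (x : R) : is_derive x 1 F ((x - m) * normal_pdf m s x).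
  have dp := is_derive_normal_pdf m s x s1.
  have -> : F = (- s ^+ 2) \*: normal_pdf m s by [].
  by apply: is_derive_eq; rewrite /GRing.scale/=; field.
rewrite (@integrable_FTC2_setT _ F 0 0)//.
- by rewrite subrr.
- by have := continuous_normal_moment m s 1 s1; under eq_fun do rewrite expr1.
- exact: (integrable_normal_moment m s 1).
- rewrite -[X in _ --> X](mulr0 (- s ^+ 2)); apply: cvgM; first exact: cvg_cst.
  have := @cvg_normal_moment0y m s 0 s0 isT.
  by under eq_fun do rewrite expr0 mul1r.
- rewrite -[X in _ --> X](mulr0 (- s ^+ 2)); apply: cvgM; first exact: cvg_cst.
  have := @cvg_normal_moment0Ny m s 0 s0 isT.
  by under eq_fun do rewrite expr0 mul1r.
Qed.

Lemma integral_normal_moment2 (m s : R) : 0 < s ->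
  (\int[mu]_x ((x - m) ^+ 2 * normal_pdf m s x)%:E = (s ^+ 2)%:E)%E.
Proof.
move=> s0; have s1 := lt0r_neq0 s0.
pose f x := (x - m) ^+ 2 * normal_pdf m s x - s ^+ 2 * normal_pdf m s x.
have i2 := integrable_normal_moment m s 2 s0 isT.
have ip : mu.-integrable setT (fun x => (s ^+ 2)%:E * (normal_pdf m s x)%:E)%E.
  by apply: integrableZl => //; exact: integrable_normal_pdf.
pose F x := - s ^+ 2 * ((x - m) ^+ 1 * normal_pdf m s x).
have dF (x : R) : is_derive x 1 F (f x).
  have dp := is_derive_normal_pdf m s x s1.
  have -> : F = (- s ^+ 2) \*: ((id - cst m) * normal_pdf m s) by [].
  by apply: is_derive_eq; rewrite /GRing.scale/= !fctE subr0 mulr1 /f; field.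
have : (\int[mu]_x (f x)%:E = 0)%E.
  rewrite (@integrable_FTC2_setT _ F 0 0)//.
  - by rewrite subrr.
  - move=> x; apply: cvgB; first exact: continuous_normal_moment.
    by apply: cvgM; [exact: cvg_cst|exact: continuous_normal_pdf].
  - by apply: eq_integrable (integrableB _ i2 ip).
  - rewrite -[X in _ --> X](mulr0 (- s ^+ 2)); apply: cvgM; first exact: cvg_cst.
    exact: (@cvg_normal_moment0y m s 1 s0 isT).
  - rewrite -[X in _ --> X](mulr0 (- s ^+ 2)); apply: cvgM; first exact: cvg_cst.
    exact: (@cvg_normal_moment0Ny m s 1 s0 isT).
have -> : (\int[mu]_x (f x)%:E = \int[mu]_x
    (((x - m) ^+ 2 * normal_pdf m s x)%:E
      - (s ^+ 2)%:E * (normal_pdf m s x)%:E))%E by [].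
rewrite integralB// integralZl//; last exact: integrable_normal_pdf.
rewrite integral_normal_pdf mule1 => /eqP.
have i2fin := integrable_fin_num measurableT i2.
by rewrite sube_eq ?add0e ?fin_num_adde_defl// => /eqP.
Qed.

End WholeLine.

(** * Integration against the normal law *)

Section IntegralNormalProb.
Context {R : realType}.
Local Notation mu := (@lebesgue_measure R).
Local Open Scope ereal_scope.

(** The density and the Radon-Nikodym derivative have the same integral over
    every measurable set, hence agree almost everywhere. *)
Lemma ge0_integral_normal_prob (m s : R) (f : R -> \bar R) :
  (forall x, 0 <= f x) -> measurable_fun setT f ->
  \int[normal_prob m s]_x f x = \int[mu]_x (f x * (normal_pdf m s x)%:E).
Proof.
move=> f0 mf.
have dom := normal_prob_dominates m s.
rewrite -(Radon_Nikodym_SigmaFinite.change_of_variables dom)//.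
have iRN := Radon_Nikodym_SigmaFinite.f_integrable dom.
have mp : measurable_fun setT (fun x => (normal_pdf m s x)%:E).
  by apply/measurable_EFinP; exact: measurable_normal_pdf.
apply: ae_eq_integral => //.
- by apply: emeasurable_funM => //; exact: measurable_int iRN.
- exact: emeasurable_funM.
- apply: ae_eqe_mul2l; apply: integral_ae_eq => // E _ mE.
  by rewrite -Radon_Nikodym_SigmaFinite.f_integral.
Qed.

(** The density being nonnegative and finite, multiplying by it commutes with
    taking positive and negative parts, which reduces the formula to the
    nonnegative case. *)
Lemma integral_normal_prob (m s : R) (f : R -> \bar R) :
  measurable_fun setT f ->
  \int[normal_prob m s]_x f x = \int[mu]_x (f x * (normal_pdf m s x)%:E).
Proof.
move=> mf; rewrite integralE [RHS]integralE; congr (_ - _).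
- rewrite ge0_integral_normal_prob//; last exact: measurable_funepos.
  apply: eq_integral => x _.
  by rewrite !funeposE maxe_pMl ?lee_fin ?normal_pdf_ge0// mul0e.
- rewrite ge0_integral_normal_prob//; last exact: measurable_funeneg.
  apply: eq_integral => x _.
  by rewrite !funenegE maxe_pMl ?lee_fin ?normal_pdf_ge0// mul0e mulNe.
Qed.

End IntegralNormalProb.

(** * Log-likelihoods that are quadratic in the parameter *)

Section QuadraticLikelihood.
Context {R : realType}.
Local Notation RB := (measurableTypeR R).

(** Written with three coefficients rather than as a polynomial so that
    differentiation stays within the family: it sends [(a, b, c)] to
    [(0, 2 * a, b)]. *)
Definition quad (a b c w : R) : R := a * w ^+ 2 + b * w + c.

Lemma is_derive_quad a b c (w : R) :
  is_derive w 1 (quad a b c) (quad 0 (2 * a) b w).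
Proof.
have -> : quad a b c = (a \*: id ^+ 2 + b \*: id + cst c).
  by apply/funext => z; rewrite /quad !fctE.
by apply: is_derive_eq; rewrite /quad /GRing.scale/= expr1; ring.
Qed.

Lemma derive1_quad a b c : derive1 (quad a b c) = quad 0 (2 * a) b.
Proof.
apply/funext => w; rewrite derive1E.
exact: (@derive_val _ _ _ _ _ _ _ (is_derive_quad a b c w)).
Qed.

Lemma dw1_quad a (b c : R -> R) y w :
  dw 1 (fun y => quad a (b y) (c y)) y w = 2 * a * w + b y.
Proof. by rewrite /dw derive1n1 derive1_quad /quad mul0r add0r. Qed.

Lemma dw2_quad a (b c : R -> R) y w :
  dw 2 (fun y => quad a (b y) (c y)) y w = 2 * a.
Proof.
by rewrite /dw derive1nS derive1n1 !derive1_quad /quad !(mul0r, mulr0, add0r).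
Qed.

Lemma dw3_quad a (b c : R -> R) y w :
  dw 3 (fun y => quad a (b y) (c y)) y w = 0.
Proof.
by rewrite /dw !derive1nS derive1n0 !derive1_quad /quad !(mul0r, mulr0, add0r).
Qed.

Lemma sup_norm_cst (I : Type) (D : set I) (h : I -> R) (c : R) :
  (forall i, h i = c) -> (sup_norm D h < +oo)%E.
Proof.
move=> hc; apply: (@le_lt_trans _ _ (`|c|)%:E); last exact: ltry.
by apply: ge_ereal_sup => _ [i _ <-]; rewrite hc.
Qed.

(** The leading coefficient [a] is the same for all observations, so the two
    supremum norms are those of constants. *)
Lemma F0_cond_quad (mu : {measure set RB -> \bar R}) (g0 : R -> R -> R)
    (a : R) (b c : R -> R) :
  measurable_fun [set: RB] (b : RB -> RB) ->
  measurable_fun [set: RB] (c : RB -> RB) ->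
  (\int[mu]_y (expR (c y))%:E < +oo)%E ->
  (\int[mu]_y (`|b y| ^+ 4 * expR (g0 y 0))%:E < +oo)%E ->
  F0_cond mu setT g0 (fun y => quad a (b y) (c y)).
Proof.
move=> mb mc ic ib; split.
- rewrite setXTT; apply: measurable_funD.
    apply: measurable_funD.
      by apply: measurable_funM => //; exact: measurable_funX.
    by apply: measurable_funM => //; exact: measurableT_comp.
  exact: measurableT_comp.
- move=> y w _; split.
    move=> k _.
    have [a' [b' [c' dwk]]] : exists a' b' c',
        dw k (fun y => quad a (b y) (c y)) y = quad a' b' c'.
      elim: k => [|k [a' [b' [c' IH]]]]; first by exists a, (b y), (c y).
      exists 0, (2 * a'), b'; rewrite -(derive1_quad a' b' c') -IH.
      by apply/funext => z; rewrite /dw derive1nS.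
    rewrite dwk.
    exact: (@ex_derive _ _ _ _ _ _ _ (is_derive_quad a' b' c' w)).
  rewrite (_ : dw 3 _ y = cst 0); first exact: cst_continuous.
  by apply/funext => z; rewrite dw3_quad.
- by under eq_integral do rewrite /quad expr0n mulr0 mulr0 !add0r.
- by under eq_integral do rewrite dw1_quad mulr0 add0r.
- split; [apply: (sup_norm_cst _ _ _ (2 * a))|apply: (sup_norm_cst _ _ _ 0)].
    by move=> y; rewrite dw2_quad.
  by move=> p; rewrite dw3_quad.
Qed.

End QuadraticLikelihood.

(** * Affine and quadratic statistics of a normal variable *)

Section AffineMoments.
Context {R : realType}.
Local Notation mu := (@lebesgue_measure R).

Lemma expr4D_le (x y : R) : (x + y) ^+ 4 <= 8 * x ^+ 4 + 8 * y ^+ 4.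
Proof.
have -> : 8 * x ^+ 4 + 8 * y ^+ 4 = (x + y) ^+ 4 +
    ((x - y) ^+ 4 + 6 * (x ^+ 2 - y ^+ 2) ^+ 2) by ring.
by rewrite lerDl addr_ge0 ?exprn_even_ge0// mulr_ge0// sqr_ge0.
Qed.

Lemma normal_affine_moment4_lty (m s p q : R) : 0 < s ->
  (\int[mu]_y (`|p * (y - m) + q| ^+ 4 * normal_pdf m s y)%:E < +oo)%E.
Proof.
move=> s0.
pose g y := 8 * p ^+ 4 * ((y - m) ^+ 4 * normal_pdf m s y)
  + 8 * q ^+ 4 * normal_pdf m s y.
have ig : mu.-integrable setT (EFin \o g).
  rewrite (_ : _ \o _ =
      (fun y => (8 * p ^+ 4)%:E * ((y - m) ^+ 4 * normal_pdf m s y)%:E) \+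
      (fun y => (8 * q ^+ 4)%:E * (normal_pdf m s y)%:E))%E//.
  apply: integrableD => //; apply: integrableZl => //.
    exact: integrable_normal_moment.
  exact: integrable_normal_pdf.
have := integrable_lty measurableT ig; apply: le_lt_trans.
have p4 (y : R) : 0 <= `|p * (y - m) + q| ^+ 4 * normal_pdf m s y.
  by rewrite mulr_ge0 ?normal_pdf_ge0// exprn_ge0.
apply: ge0_le_integral => //.
- by move=> y _; rewrite lee_fin.
- apply/measurable_EFinP/measurable_funM; last exact: measurable_normal_pdf.
  apply: measurable_funX; apply: measurableT_comp => //.
  apply: measurable_funD => //; apply: measurable_funM => //.
  exact: measurable_funB.
- exact: measurable_int ig.
- move=> y _; rewrite lee_fin /g mulrA -mulrDl ler_wpM2r ?normal_pdf_ge0//.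
  rewrite -normrX ger0_norm ?exprn_even_ge0//.
  by rewrite (le_trans (expr4D_le _ _))// exprMn mulrA.
Qed.

Lemma integral_normal_quadratic (m s p q r : R) : 0 < s ->
  (\int[mu]_y ((p * (y - m) ^+ 2 + q * (y - m) + r) * normal_pdf m s y)%:E =
    (p * s ^+ 2 + r)%:E)%E.
Proof.
move=> s0.
have i2 := integrable_normal_moment m s 2 s0 isT.
have i1 := integrable_normal_moment m s 1 s0 isT.
have i0 := integrable_normal_pdf m s.
under eq_integral => y _.
  rewrite (_ : _ * normal_pdf m s y =
    p * ((y - m) ^+ 2 * normal_pdf m s y)
    + (q * ((y - m) ^+ 1 * normal_pdf m s y) + r * normal_pdf m s y)); last by ring.
  rewrite EFinD [(p * _)%:E]EFinM EFinD [(q * _)%:E]EFinM [(r * _)%:E]EFinM; over.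
rewrite integralD//; last 2 first.
- exact: integrableZl.
- by apply: integrableD => //; exact: integrableZl.
rewrite integralD//; last 2 first.
- exact: integrableZl.
- exact: integrableZl.
rewrite !integralZl// integral_normal_moment2// integral_normal_pdf.
under eq_integral do rewrite expr1.
by rewrite integral_normal_moment1// mule0 add0e mule1.
Qed.

End AffineMoments.

(** * The Gaussian inference task *)

Section GaussianTask.
Context {R : realType}.
Local Notation mu := (@lebesgue_measure R).
Context (b1 b2 b3 b4 : R) (b1_gt0 : 0 < b1).
Local Notation s := (Num.sqrt b1).

Lemma gU0_quad : gU0 (b1, b2, b3, b4) =
  fun y => quad (- (2 * b1)^-1 * b2 ^+ 2) (b2 / b1 * (y - b4))
    (gU0 (b1, b2, b3, b4) y 0).
Proof.
apply/funext => y; apply/funext => w; rewrite /gU0 /quad.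
by field; rewrite gt_eqF.
Qed.

Lemma gU1_quad : gU1 (b1, b2, b3, b4) =
  fun y => quad (- b3 / 2) y (- y ^+ 2 / 2).
Proof.
by apply/funext => y; apply/funext => w; rewrite /gU1 /quad; field.
Qed.

Lemma expR_gU0 y w :
  expR (gU0 (b1, b2, b3, b4) y w) = normal_pdf (b2 * w + b4) s y.
Proof.
rewrite normal_pdfE ?gt_eqF ?sqrtr_gt0// /normal_fun /normal_peak /gU0.
rewrite sqr_sqrtr ?ltW// expRD mulrC; congr (_ * expR _); last first.
  by field; rewrite gt_eqF.
have -> : b1 * pi *+ 2 = 2 * pi * b1 by ring.
have p0 : 0 < 2 * pi * b1 by rewrite !mulr_gt0// pi_gt0.
rewrite expRN; congr _^-1.
apply/eqP; rewrite -(@eqrXn2 _ 2)// ?expR_ge0 ?sqrtr_ge0//.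
by rewrite -expRM_natl mulrA mulfV ?mul1r ?lnK ?sqr_sqrtr ?ltW// posrE.
Qed.

Lemma expR_gU00 y : expR (gU0 (b1, b2, b3, b4) y 0) = normal_pdf b4 s y.
Proof. by rewrite expR_gU0 mulr0 add0r. Qed.

Lemma is_inference_task_gU :
  is_inference_task mu (gU0 (b1, b2, b3, b4)) (gU1 (b1, b2, b3, b4)).
Proof.
have s0 : 0 < s by rewrite sqrtr_gt0.
split; first by left.
  near=> w; under eq_integral do rewrite expR_gU0.
  exact: integral_normal_pdf.
exists setT; split => //; first exact: openT.
- rewrite {2}gU0_quad; apply: F0_cond_quad.
  + by apply: measurable_funM => //; exact: measurable_funB.
  + rewrite /gU0; apply: measurable_funB => //; apply: measurable_funM => //.
    by apply: measurable_funX; apply: measurable_funB => //; exact: measurable_funB.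
  + under eq_integral do rewrite expR_gU00.
    by rewrite integral_normal_pdf ltry.
  + have := normal_affine_moment4_lty b4 s (b2 / b1) 0 s0.
    by under eq_integral do rewrite addr0 -expR_gU00.
- rewrite gU1_quad; apply: F0_cond_quad.
  + exact: measurable_id.
  + by apply: measurable_funM => //; apply: measurableT_comp => //.
  (* at [w = 0], the exponential of the pseudo-likelihood is a multiple of the
     standard normal density *)
  + have p1 : normal_peak 1 != 0 :> R by rewrite gt_eqF ?normal_peak_gt0.
    rewrite (eq_integral
      (fun y : measurableTypeR R =>
        (normal_peak 1)^-1%:E * (normal_pdf 0 1 y)%:E)%E); last first.
      move=> y _; rewrite -EFinM normal_pdfE// mulKf// /normal_fun.
      by rewrite subr0 expr1n.
    apply: integrable_lty => //; apply: integrableZl => //.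
    exact: integrable_normal_pdf.
  + have := normal_affine_moment4_lty b4 s 1 b4 s0.
    by under eq_integral do rewrite mul1r subrK -expR_gU00.
Unshelve. all: by end_near. Qed.

(** The law of the observation coincides with the normal law on measurable
    sets, which is all that integrals depend on. *)
Lemma expectation_gU (U : is_inference_task mu (gU0 (b1, b2, b3, b4))
    (gU1 (b1, b2, b3, b4))) (X : R -> R) : measurable_fun setT X ->
  ('E_(law0 (InferenceTask U))[X] =
   \int[mu]_y (X y * normal_pdf b4 s y)%:E)%E.
Proof.
move=> mX; rewrite unlock.
rewrite (@eq_measure_integral _ _ _ _ (normal_prob b4 s)).
  by rewrite integral_normal_prob//; exact/measurable_EFinP.
move=> A mA _; rewrite /= /law0/= /normal_prob.
by apply: eq_integral => y _; rewrite expR_gU00.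
Qed.

Lemma info_params_gU (U : is_inference_task mu (gU0 (b1, b2, b3, b4))
    (gU1 (b1, b2, b3, b4))) :
  info_params (InferenceTask U) = (b1, b2, b3, b4).
Proof.
have s0 : 0 < s by rewrite sqrtr_gt0.
have dg y : dw 1 (gU1 (b1, b2, b3, b4)) y 0 = y.
  by rewrite gU1_quad dw1_quad mulr0 add0r.
have dg0 y : dw 1 (gU0 (b1, b2, b3, b4)) y 0 = b2 / b1 * (y - b4).
  by rewrite gU0_quad dw1_quad mulr0 add0r.
have d2g y : dw 2 (gU1 (b1, b2, b3, b4)) y 0 = - b3.
  by rewrite gU1_quad dw2_quad; field.
have i4 : info4 (InferenceTask U) = b4.
  rewrite /info4 (_ : (fun y => _) = id); last by apply/funext; exact: dg.
  rewrite expectation_gU//.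
  transitivity (fine (0 * s ^+ 2 + b4)%:E); last by rewrite /= mul0r add0r.
  rewrite -(integral_normal_quadratic b4 s 0 1 b4 s0); congr fine.
  by apply: eq_integral => y _; congr (_ * _)%:E; ring.
rewrite /info_params i4; congr (_, _, _, _).
- rewrite /info1 i4 (_ : (fun y => _) = (fun y => (y - b4) ^+ 2)); last first.
    by apply/funext => y; exact: (congr1 (fun u => (u - b4) ^+ 2) (dg y)).
  rewrite expectation_gU; last first.
    by apply: measurable_funX; exact: measurable_funB.
  by rewrite integral_normal_moment2// sqr_sqrtr// ltW.
(* [y] is split as [(y - b4) + b4]: the first part gives the variance, the
   second a multiple of the centred first moment *)
- rewrite /info2 (_ : (fun y => _) = (fun y => y * (b2 / b1 * (y - b4)))); last first.
    by apply/funext => y; exact: (congr2 *%R (dg y) (dg0 y)).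
  rewrite expectation_gU; last first.
    apply: measurable_funM => //; apply: measurable_funM => //.
    exact: measurable_funB.
  transitivity (fine (b2 / b1 * s ^+ 2 + 0)%:E); last first.
    by rewrite /= sqr_sqrtr ?ltW// addr0 divfK ?gt_eqF.
  rewrite -(integral_normal_quadratic b4 s (b2 / b1) (b2 / b1 * b4) 0 s0).
  by congr fine; apply: eq_integral => y _; congr (_ * _)%:E; ring.
- rewrite /info3 (_ : (fun y => _) = cst (- b3)); last first.
    by apply/funext; exact: d2g.
  by rewrite expectation_cst/= opprK.
Qed.

End GaussianTask.

Theorem theorem3p1 (R : realType) (T : inference_task R) (b1 b2 b3 b4 : R)
    (hb : info_params T = (b1, b2, b3, b4)) (hb1 : 0 < b1) :
  exists hU : is_inference_task (@lebesgue_measure R)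
      (gU0 (b1, b2, b3, b4)) (gU1 (b1, b2, b3, b4)),
    strongly_equivalent T (InferenceTask hU).
Proof.
exists (is_inference_task_gU b1 b2 b3 b4 hb1).
by rewrite /strongly_equivalent hb info_params_gU.
Qed.
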